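(* The following are true. (1) Let $a,b\ge 1$ be integers, $\vec\alpha\in\mathbb{Z}_{+}^a$ and $\vec\beta\in\mathbb{Z}_{+}^b$. Then there are rational numbers $c_{\vec w}$ (all but finitely many zero, and independent of $n$) such that for every positive integer $n$ we have $$\sum_{i+j=n}M_{\vec\alpha}(i)M_{\vec\beta}(j)=\sum_{|\vec w|\leq|\vec\alpha|+|\vec\beta|+a+b-1}c_{\vec w}\,M_{\vec w}(n).$$ (2) Let $a\ge 1$ be an integer and $\vec\alpha\in\mathbb{Z}_{+}^a$. Then there are rational numbers $c_{\vec w}$ (all but finitely many zero, and independent of $n$) such that for every positive integer $n$ we have $$n\,M_{\vec\alpha}(n)=\sum_{|\vec w|\leq|\vec\alpha|+a+1}c_{\vec w}\,M_{\vec w}(n).$$ In both parts the sum on the right runs over vectors $\vec w$ of non-negative integers, of arbitrary positive length, satisfying the stated bound on $|\vec w|$; the convolution sum runs over positive integers $i,j$ with $i+j=n$.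
   Context: $\mathbb{Z}_+$ denotes the positive integers. For an integer $\ell\geq 1$ and a vector $\vec w=(v_1,\dots,v_\ell)$ of non-negative integers, put $|\vec w|:=v_1+\cdots+v_\ell$, and define the MacMahonesque partition function, for positive integers $n$, by $$M_{\vec w}(n):=\sum_{\substack{0<s_1<s_2<\cdots<s_\ell\\ m_1,\dots,m_\ell>0\\ n=m_1s_1+\cdots+m_\ell s_\ell}} m_1^{v_1}m_2^{v_2}\cdots m_\ell^{v_\ell},$$ where the $s_i$ and $m_i$ are integers. *)

(* Defs.v *)
From HB Require Import structures.
From mathcomp Require Import all_boot all_order all_algebra finmap.
Set Implicit Arguments.
Unset Strict Implicit.
Unset Printing Implicit Defensive.

(* Positive [m i], [s i] with [\sum_i m i * s i = n] are all at most [n], so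
   letting them range over ['I_n.+1] loses no solution. The entries of [w] are
   indexed from 0: [nth 0 w i] is the exponent usually written v_{i+1}. *)
Definition MacMahonesque (w : seq nat) (n : nat) : nat :=
  \sum_(s : {ffun 'I_(size w) -> 'I_n.+1} |
        [forall i, 0 < s i] &&
        [forall i : 'I_(size w), forall j : 'I_(size w), (i < j) ==> (s i < s j)])
    \sum_(m : {ffun 'I_(size w) -> 'I_n.+1} |
          [forall i, 0 < m i] && (n == \sum_(i < size w) m i * s i))
      \prod_(i < size w) m i ^ nth 0 w i.

(* Main.v *)
Require Import Defs.
From HB Require Import structures.
From mathcomp Require Import all_boot all_order all_algebra finmap.
From mathcomp Require Import zify ring.
Set Implicit Arguments.
Unset Strict Implicit.
Unset Printing Implicit Defensive.
Import Order.TTheory GRing.Theory Num.Theory.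
Local Open Scope ring_scope.

(** A partition with distinct parts s_1 < ... < s_l and multiplicities
    m_1, ..., m_l has size n = m_1 s_1 + ... + m_l s_l, so M_w(n) is the sum of
    the monomial with exponents w in the multiplicities over the partitions of
    n with l distinct parts. Hence the combinations of the M_w are the
    coefficient sequences of the series sum f(m_1, ..., m_l) X^n over all
    partitions, with f polynomial for each l, and both parts ask that an
    operation on such series (multiplication, and the Euler derivation
    theta = X d/dX, which multiplies the n-th coefficient by n) preserves them
    with control of the degree.

    Products. Superposing two partitions adds multiplicities. A part of the
    superposition comes from one of the two partitions or from both; in the
    last case its multiplicity m is split as (m - k) + k with 0 < k < m, and
    the sum of (m - k)^v k^v' is a polynomial in m of degree v + v' + 1
    ([convolved_power_sum]). So the product is a quasi-shuffle
    ([mult_seriesM], [poly_weight_stuffle]), in which the degree grows by one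
    for each common part. There are at most min(a, b) <= a + b - 1 of these.

    Derivatives. The distinct parts of the conjugate partition are the partial
    sums m_l, m_l + m_(l-1), ..., so conjugation turns the weight f into a
    function g of the distinct parts alone, polynomial in these
    ([part_series_conjugate]). For such weights multiply by the series sigma of
    S X^(S U) over all S, U >= 1, that is, add U copies of a part S. If S was
    absent, this changes the set of parts; otherwise the resulting
    multiplicity u of S arises in u - 1 ways. The sum of S (u - 1) over the
    distinct parts being the size minus the sum of the distinct parts, one gets
    [theta_part_series]:
      theta V(g) = sigma V(g) + V((sum of parts) g) - V(insertion g),
    where V(g) is the series of weight g. Conjugating back, the last two terms
    have weights polynomial in the multiplicities, of degree |w| + 1. Since
    sigma is the series of M_(1), the first term is a product as above, with at
    most one coincidence, hence of degree at most |w| + 2 <= |w| + a + 1. *)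

(** * Polynomials up to a degree *)

(** Congruence modulo ['X^n.+1]. Bounding parts and multiplicities by [n] turns
    generating functions into polynomials without changing their coefficients
    in degrees at most [n]. *)
Definition eq_upto (n : nat) (P Q : {poly rat}) :=
  forall i, (i <= n)%N -> P`_i = Q`_i.

Lemma eq_upto_refl n P : eq_upto n P P. Proof. by []. Qed.

Lemma eq_upto_sym n P Q : eq_upto n P Q -> eq_upto n Q P.
Proof. by move=> eqPQ i /eqPQ. Qed.

Lemma eq_upto_trans n Q P R : eq_upto n P Q -> eq_upto n Q R -> eq_upto n P R.
Proof. by move=> e1 e2 i le_in; rewrite e1 ?e2. Qed.

Lemma eq_uptoD n P Q P' Q' :
  eq_upto n P Q -> eq_upto n P' Q' -> eq_upto n (P + P') (Q + Q').
Proof. by move=> e1 e2 i le_in; rewrite !coefD e1 ?e2. Qed.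

Lemma eq_uptoM n P Q P' Q' :
  eq_upto n P Q -> eq_upto n P' Q' -> eq_upto n (P * P') (Q * Q').
Proof.
move=> e1 e2 i le_in; rewrite !coefM; apply: eq_bigr => j _.
by rewrite e1 ?e2 //; have := ltn_ord j; lia.
Qed.

Lemma eq_upto_sum_nat n a b (F G : nat -> {poly rat}) :
    (forall i, (a <= i < b)%N -> eq_upto n (F i) (G i)) ->
  eq_upto n (\sum_(a <= i < b) F i) (\sum_(a <= i < b) G i).
Proof.
move=> eFG k le_kn; rewrite !coef_sum.
by apply: eq_big_nat => i /eFG; apply.
Qed.

Lemma eq_upto_sum0 n a b (F : nat -> {poly rat}) :
    (forall i, (a <= i < b)%N -> eq_upto n (F i) 0) ->
  eq_upto n (\sum_(a <= i < b) F i) 0.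
Proof.
move=> F0; apply: (eq_upto_trans (eq_upto_sum_nat F0)).
by rewrite big1_eq; apply: eq_upto_refl.
Qed.

Lemma eq_upto_Xn0 n k P : (n < k)%N -> eq_upto n ('X^k * P) 0.
Proof.
by move=> lt_nk i le_in; rewrite coefXnM coef0 (leq_ltn_trans le_in).
Qed.

(** Two copies of the range [0, N] give sums up to [2 * N]; those beyond [N]
    carry an exponent that the truncation discards. *)
Lemma eq_upto_antidiag0 N (G : nat -> nat -> {poly rat}) :
    (forall a b, (N < a + b)%N -> eq_upto N (G a b) 0) ->
  eq_upto N (\sum_(0 <= a < N.+1) \sum_(0 <= b < N.+1) G a b)
    (\sum_(0 <= c < N.+1) \sum_(0 <= b < c.+1) G (c - b)%N b).
Proof.
move=> G0; rewrite exchange_big_nat /=.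
have -> : \sum_(0 <= c < N.+1) \sum_(0 <= b < c.+1) G (c - b)%N b =
  \sum_(0 <= b < N.+1) \sum_(b <= c < N.+1) G (c - b)%N b.
  under eq_big_nat => c /andP[_ ltcN] do
    rewrite (big_nat_widen _ _ N.+1) //=.
  rewrite (exchange_big_dep_nat xpredT) //=; apply: eq_big_nat => b _.
  by rewrite [RHS](big_nat_widenl _ 0).
apply: eq_upto_sum_nat => b /andP[_ leb].
rewrite [X in eq_upto _ _ X](_ : _ = \sum_(0 <= a < N.+1 - b) G a b);
  last first.
  rewrite -{1}[b]add0n big_addn; apply: eq_bigr => a _; congr (G _ _); lia.
rewrite (@big_cat_nat _ _ _ (N.+1 - b)) //=; last by lia.
rewrite -[X in eq_upto _ _ X]addr0; apply: eq_uptoD => //.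
by apply: eq_upto_sum0 => a le_a; apply: G0; lia.
Qed.

(** The version for the copies of a part, which number at least one on each
    side. *)
Lemma eq_upto_antidiag1 N (G : nat -> nat -> {poly rat}) :
    (forall a b, (N < a + b)%N -> eq_upto N (G a b) 0) ->
  eq_upto N (\sum_(1 <= a < N.+1) \sum_(1 <= b < N.+1) G a b)
    (\sum_(1 <= c < N.+1) \sum_(1 <= b < c) G (c - b)%N b).
Proof.
move=> G0; pose G' a b := if (0 < a)%N && (0 < b)%N then G a b else 0.
have G'0 a b : (N < a + b)%N -> eq_upto N (G' a b) 0.
  by move=> /G0; rewrite /G'; case: ifP.
have := eq_upto_antidiag0 G'0.
have -> : \sum_(0 <= a < N.+1) \sum_(0 <= b < N.+1) G' a b =
  \sum_(1 <= a < N.+1) \sum_(1 <= b < N.+1) G a b.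
  rewrite big_ltn // [X in X + _]big1 ?add0r //.
  apply: eq_big_nat => a /andP[a_gt0 _].
  rewrite big_ltn // {1}/G' andbF add0r; apply: eq_big_nat => b /andP[b_gt0 _].
  by rewrite /G' a_gt0 b_gt0.
suff -> : \sum_(0 <= c < N.+1) \sum_(0 <= b < c.+1) G' (c - b)%N b =
  \sum_(1 <= c < N.+1) \sum_(1 <= b < c) G (c - b)%N b by [].
rewrite big_ltn // big_nat1 add0r.
apply: eq_big_nat => c /andP[c_gt0 _].
rewrite big_ltn // {1}/G' andbF add0r big_nat_recr //= {2}/G' subnn addr0.
apply: eq_big_nat => b /andP[b_gt0 ltb].
by rewrite /G' subn_gt0 ltb b_gt0.
Qed.

Lemma eq_upto_sum_shift N t (F : nat -> {poly rat}) :
    (forall T, (N < T)%N -> eq_upto N (F T) 0) ->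
  eq_upto N (\sum_(t.+1 <= T < N.+1) F T) (\sum_(1 <= m < N.+1) F (t + m)%N).
Proof.
move=> F0; have [ltNt|letN] := ltnP N t.
  rewrite big_geq ?ltnS 1?ltnW //; apply: eq_upto_sym.
  by apply: eq_upto_sum0 => m _; apply: F0; lia.
rewrite -[t.+1]add1n big_addn subSn //.
rewrite [X in eq_upto _ _ X](@big_cat_nat _ _ _ (N - t).+1) //=; last by lia.
rewrite -[X in eq_upto _ X _]addr0; apply: eq_uptoD => //.
  by under eq_bigr do rewrite addnC.
by apply: eq_upto_sym; apply: eq_upto_sum0 => a le_a; apply: F0; lia.
Qed.

(** * Partitions weighted by their multiplicities *)

(** In a list of multiplicities only the parts that do occur have an entry, so
    multiplicity [0] leaves the list as it is. *)
Definition cons_mult (f : seq nat -> rat) (m : nat) : seq nat -> rat :=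
  if m is 0%N then f else fun x => f (m :: x).

(** The sum of [f x * 'X^n] over all partitions of any [n] into parts at most
    [s], each repeated at most [N] times, where [x] lists the multiplicities of
    the distinct parts, largest part first. Weights of all lengths are treated
    at once: a weight that vanishes off the lists of size [l] selects the
    partitions with [l] distinct parts. *)
Fixpoint mult_series (N s : nat) (f : seq nat -> rat) : {poly rat} :=
  if s is s'.+1 then
    \sum_(0 <= m < N.+1) 'X^(m * s) * mult_series N s' (cons_mult f m)
  else (f [::])%:P.

Lemma eq_mult_series N s f g :
  (forall x, all (ltn 0) x -> f x = g x) ->
  mult_series N s f = mult_series N s g.
Proof.
elim: s f g => [|s IHs] f g eqfg /=; first by rewrite eqfg.
apply: eq_bigr => m _; congr (_ * _); apply: IHs => x x_gt0.
by case: m => [|m] /=; apply: eqfg.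
Qed.

Lemma mult_series_sum N s (I : Type) (r : seq I) (h : I -> seq nat -> rat) :
  mult_series N s (fun x => \sum_(i <- r) h i x) =
  \sum_(i <- r) mult_series N s (h i).
Proof.
elim: s h => [|s IHs] h /=; first by rewrite rmorph_sum.
rewrite exchange_big /=; apply: eq_bigr => m _.
rewrite -mulr_sumr -IHs; congr (_ * _).
by apply: eq_mult_series => x _; case: m => [|m].
Qed.

Lemma mult_seriesD N s f g :
  mult_series N s (fun x => f x + g x) = mult_series N s f + mult_series N s g.
Proof.
elim: s f g => [|s IHs] f g /=; first by rewrite rmorphD.
rewrite -big_split; apply: eq_bigr => m _ /=.
by rewrite -mulrDr -IHs; case: m.
Qed.

Lemma mult_seriesZ N s c f :
  mult_series N s (fun x => c * f x) = c%:P * mult_series N s f.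
Proof.
elim: s f => [|s IHs] f /=; first by rewrite rmorphM.
rewrite mulr_sumr; apply: eq_bigr => m _ /=.
by rewrite mulrCA -IHs; case: m.
Qed.

Lemma mult_series0 N s : mult_series N s (fun=> 0) = 0.
Proof.
elim: s => [|s IHs] //=; apply: big1 => m _.
by rewrite (_ : cons_mult _ m = fun=> 0) ?IHs ?mulr0 //; case: m.
Qed.

(** Sorting the partitions by their largest part [s'], which occurs [m]
    times. *)
Lemma mult_series_largest N s f : mult_series N s f =
  (f [::])%:P + \sum_(1 <= s' < s.+1) \sum_(1 <= m < N.+1)
    'X^(m * s') * mult_series N s'.-1 (fun x => f (m :: x)).
Proof.
elim: s => [|s IHs] /=; first by rewrite big_geq // addr0.
rewrite big_ltn // mul0n mul1r /= IHs [in RHS]big_nat_recr //= addrA.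
by congr (_ + _); apply: eq_big_nat => -[|m].
Qed.

Lemma mult_series_mult_bound n N s f : (n <= N)%N ->
  eq_upto n (mult_series N s f) (mult_series n s f).
Proof.
move=> lenN; elim: s f => [|s IHs] f /=; first by [].
rewrite (@big_cat_nat _ _ _ n.+1) //= -[X in eq_upto _ _ X]addr0.
apply: eq_uptoD.
  by apply: eq_upto_sum_nat => m _; apply: eq_uptoM => //; apply: IHs.
apply: eq_upto_sum0 => m /andP[ltnm _].
by apply: eq_upto_Xn0; rewrite mulnS; lia.
Qed.

Lemma mult_series_part_bound n N s f : (n <= s)%N ->
  eq_upto n (mult_series N s f) (mult_series N n f).
Proof.
move=> lens; elim: s lens => [|s IHs]; first by rewrite leqn0 => /eqP->.
rewrite leq_eqVlt => /predU1P[-> //|lt_ns].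
rewrite /= big_ltn // mul0n mul1r -[X in eq_upto _ _ X]addr0.
apply: eq_uptoD; first exact: IHs.
apply: eq_upto_sum0 => m /andP[m_gt0 _]; apply: eq_upto_Xn0.
by rewrite (leq_trans lt_ns) // leq_pmull.
Qed.

(** Superposing two partitions adds their multiplicities, so the weight of a
    superposition sums over all ways to split each multiplicity in two. On
    monomials this is the quasi-shuffle product: an entry comes from the first
    list ([k = 0]), from the second ([k = m]) or from both. *)
Fixpoint stuffle (f g : seq nat -> rat) (x : seq nat) {struct x} : rat :=
  if x is m :: y then
    \sum_(0 <= k < m.+1) stuffle (cons_mult f (m - k)) (cons_mult g k) y
  else f [::] * g [::].

Lemma mult_seriesM N s f g :
  eq_upto N (mult_series N s f * mult_series N s g)
    (mult_series N s (stuffle f g)).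
Proof.
elim: s f g => [|s IHs] f g /=; first by rewrite -rmorphM.
rewrite mulr_suml.
under [X in eq_upto _ X _]eq_bigr => a _ do rewrite mulr_sumr.
have -> : \sum_(0 <= m < N.+1) 'X^(m * s.+1) *
    mult_series N s (cons_mult (stuffle f g) m) =
  \sum_(0 <= c < N.+1) \sum_(0 <= b < c.+1)
     'X^((c - b + b) * s.+1) *
     mult_series N s (stuffle (cons_mult f (c - b)) (cons_mult g b)).
  apply: eq_big_nat => -[|c] _.
    by rewrite big_nat1 /= subn0 addn0.
  rewrite (mult_series_sum N s _
    (fun b => stuffle (cons_mult f (c.+1 - b)) (cons_mult g b))).
  rewrite mulr_sumr; apply: eq_big_nat => b /andP[_ leb].
  by rewrite subnK.
apply: eq_upto_trans
  (eq_upto_antidiag0 (G := fun a b => 'X^((a + b) * s.+1) *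
    mult_series N s (stuffle (cons_mult f a) (cons_mult g b))) _).
  apply: eq_upto_sum_nat => a _; apply: eq_upto_sum_nat => b _.
  by rewrite mulrACA -exprD -mulnDl; apply: eq_uptoM.
by move=> a b ltN; apply: eq_upto_Xn0; rewrite mulnS; lia.
Qed.

(** * Polynomial weights and their products *)

(** Lists of a size other than that of [w] get weight [0], so that a monomial
    fixes the number of distinct parts. *)
Fixpoint monomial (w x : seq nat) : rat :=
  match w, x with
  | [::], [::] => 1
  | v :: w', m :: x' => m%:R ^+ v * monomial w' x'
  | _, _ => 0
  end.

(** The weights whose series are combinations of the series of exponent
    vectors of sum at most [k]. Agreement is required on positive lists
    only, since no other list is a list of multiplicities. *)
Definition poly_weight (k : nat) (f : seq nat -> rat) :=
  exists2 r : seq (rat * seq nat), all (fun p => sumn p.2 <= k)%N r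
    & forall x, all (ltn 0) x -> f x = \sum_(p <- r) p.1 * monomial p.2 x.

Lemma poly_weight_monomial w : poly_weight (sumn w) (monomial w).
Proof.
exists [:: (1, w)]; first by rewrite /= leqnn.
by move=> x _; rewrite big_seq1 mul1r.
Qed.

Lemma eq_poly_weight k f g : (forall x, all (ltn 0) x -> f x = g x) ->
  poly_weight k g -> poly_weight k f.
Proof. by move=> eqfg [r kr gE]; exists r => // x x0; rewrite eqfg ?gE. Qed.

Lemma poly_weight_leq k k' f :
  (k <= k')%N -> poly_weight k f -> poly_weight k' f.
Proof.
move=> lekk [r kr fE]; exists r => //; apply: sub_all kr => p /leq_trans; exact.
Qed.

Lemma poly_weight0 k : poly_weight k (fun=> 0).
Proof. by exists [::] => // x _; rewrite big_nil. Qed.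

Lemma poly_weightD k f g :
  poly_weight k f -> poly_weight k g -> poly_weight k (fun x => f x + g x).
Proof.
move=> [r kr fE] [r' kr' gE]; exists (r ++ r'); first by rewrite all_cat kr.
by move=> x x0; rewrite big_cat fE ?gE.
Qed.

Lemma poly_weightZ k c f : poly_weight k f -> poly_weight k (fun x => c * f x).
Proof.
move=> [r kr fE]; exists [seq (c * p.1, p.2) | p <- r].
  by rewrite all_map.
move=> x x0; rewrite big_map fE // mulr_sumr.
by apply: eq_bigr => p _; rewrite mulrA.
Qed.

Lemma poly_weight_sum k (I : Type) (r : seq I) (h : I -> seq nat -> rat) :
  (forall i, poly_weight k (h i)) ->
  poly_weight k (fun x => \sum_(i <- r) h i x).
Proof.
move=> kh; elim: r => [|i r IHr].
  by apply: eq_poly_weight (poly_weight0 k) => x _; rewrite big_nil.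
by apply: eq_poly_weight (poly_weightD (kh i) IHr) => x _; rewrite big_cons.
Qed.

Definition cons_weight (c : nat -> rat) f (x : seq nat) : rat :=
  if x is m :: y then c m * f y else 0.

Lemma poly_weight_cons_exp v k f : poly_weight k f ->
  poly_weight (v + k) (cons_weight (fun m => m%:R ^+ v) f).
Proof.
move=> [r kr fE]; exists [seq (p.1, v :: p.2) | p <- r].
  by rewrite all_map; apply: sub_all kr => p /=; rewrite leq_add2l.
move=> [|m x] /=; first by rewrite big_map big1 // => p _; rewrite mulr0.
case/andP=> _ /fE ->; rewrite big_map mulr_sumr.
by apply: eq_bigr => p _; rewrite mulrCA.
Qed.

Lemma poly_weight_cons_poly d k (p : {poly rat}) c f : (size p <= d.+1)%N ->
    (forall m, (0 < m)%N -> c m = p.[m%:R]) ->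
  poly_weight k f -> poly_weight (d + k) (cons_weight c f).
Proof.
move=> sz_p cE kf.
pose h (i : 'I_(size p)) x := p`_i * cons_weight (fun m => m%:R ^+ i) f x.
apply: (@eq_poly_weight _ _ (fun x => \sum_i h i x)).
  move=> [|m x] /=; first by rewrite /h big1 // => i _; rewrite mulr0.
  case/andP=> m_gt0 _; rewrite cE // horner_coef mulr_suml.
  by apply: eq_bigr => i _; rewrite /h /= mulrA.
apply: poly_weight_sum => i; apply: poly_weightZ.
apply: (@poly_weight_leq (i + k)); last exact: poly_weight_cons_exp.
by rewrite leq_add2r -ltnS (leq_trans _ sz_p).
Qed.

(** Expanding the telescoping sum of [k.+1 ^+ v.+1 - k ^+ v.+1] expresses
    [v.+1] times the sum of [k ^+ v] through lower power sums. *)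
Lemma power_sum v : exists2 p : {poly rat}, (size p <= v.+2)%N &
  forall m : nat, (0 < m)%N -> \sum_(1 <= k < m) k%:R ^+ v = p.[m%:R].
Proof.
have [n] := ubnP v; elim: n v => // n IHn v ltvn.
have /fin_all_exists2[p sz_p pE] : forall i : 'I_v,
    exists2 p : {poly rat}, (size p <= i.+2)%N &
    forall m : nat, (0 < m)%N -> \sum_(1 <= k < m) k%:R ^+ i = p.[m%:R].
  by move=> i; apply: IHn; apply: leq_trans (ltn_ord i) _.
exists (v.+1%:R^-1 *: ('X^(v.+1) - 1 - \sum_(i < v) 'C(v.+1, i)%:R *: p i)).
  apply: leq_trans (size_scale_leq _ _) _.
  apply: leq_trans (size_polyD _ _) _; rewrite geq_max size_polyN.
  apply/andP; split.
    apply: leq_trans (size_polyD _ _) _.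
    by rewrite geq_max size_polyN size_polyXn size_poly1 leqnn.
  apply: leq_trans (size_sum _ _ _) _; apply/bigmax_leqP => i _.
  apply: leq_trans (size_scale_leq _ _) (leq_trans (sz_p i) _).
  by rewrite ltnS ltnW // ltnS.
move=> m m_gt0.
have telescoped : \sum_(1 <= k < m) (k.+1%:R ^+ v.+1 - k%:R ^+ v.+1) =
    m%:R ^+ v.+1 - 1 :> rat.
  by rewrite (telescope_sumr (fun k => k%:R ^+ v.+1)) // expr1n.
rewrite hornerZ !hornerD !hornerN hornerXn hornerC horner_sum -telescoped.
apply: (canRL (mulKf _)); first by rewrite pnatr_eq0.
apply/eqP; rewrite eq_sym subr_eq; apply/eqP.
under [X in _ = _ + X]eq_bigr => i _ do rewrite hornerZ -pE // mulr_sumr.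
rewrite exchange_big /= mulr_sumr -big_split /=; apply: eq_bigr => k _.
rewrite -(natr1 k) exprD1n.
rewrite !big_ord_recr /= binn mulr1n addrK binSn.
rewrite addrC mulr_natl; congr (_ + _).
by apply: eq_bigr => i _; rewrite mulr_natl.
Qed.

(** Writing one factor [m - k] as [m] minus [k] trades the exponent [v.+1] for
    [v], either with a factor [m] or with [v'] raised by one; both raise the
    degree by one. *)
Lemma convolved_power_sum v v' :
  exists2 p : {poly rat}, (size p <= (v + v').+2)%N &
  forall m : nat, (0 < m)%N ->
    \sum_(1 <= k < m) (m - k)%:R ^+ v * k%:R ^+ v' = p.[m%:R].
Proof.
elim: v v' => [|v IHv] v'.
  have [p sz_p pE] := power_sum v'; exists p => // m m_gt0; rewrite -pE //.
  by apply: eq_bigr => k _; rewrite mul1r.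
have [p sz_p pE] := IHv v'; have [q sz_q qE] := IHv v'.+1.
exists (p * 'X - q).
  apply: leq_trans (size_polyD _ _) _; rewrite geq_max size_polyN.
  rewrite -addSnnS in sz_q; rewrite sz_q andbT.
  by rewrite (leq_trans (size_polyMleq _ _)) // size_polyX addn2.
move=> m m_gt0; rewrite hornerD hornerN hornerMX -pE // -qE //.
rewrite mulr_suml -sumrB; apply: eq_big_nat => k /andP[_ ltkm].
by rewrite exprS (exprS _ v') natrB 1?ltnW //; ring.
Qed.

Lemma eq_stuffle f f' g g' : f =1 f' -> g =1 g' -> stuffle f g =1 stuffle f' g'.
Proof.
move=> + + x; elim: x f f' g g' => [|m x IHx] f f' g g' ff' gg' /=.
  by rewrite ff' gg'.
apply: eq_bigr => k _; apply: IHx => y; first by case: (m - k)%N => [|?] /=.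
by case: k => [|?] /=.
Qed.

Lemma stuffleZ c d f g x :
  stuffle (fun y => c * f y) (fun y => d * g y) x = (c * d) * stuffle f g x.
Proof.
elim: x f g => [|m x IHx] f g /=; first by rewrite mulrACA.
rewrite mulr_sumr; apply: eq_bigr => k _; rewrite -IHx.
by apply: eq_stuffle => y; [case: (m - k)%N | case: k].
Qed.

Lemma stuffle0l f g x : f =1 (fun=> 0) -> stuffle f g x = 0.
Proof.
move=> f0; rewrite (@eq_stuffle _ (fun y => 0 * f y) g (fun y => 1 * g y)).
- by rewrite stuffleZ !mul0r.
- by move=> y; rewrite f0 mul0r.
- by move=> y; rewrite mul1r.
Qed.

Lemma stuffle0r f g x : g =1 (fun=> 0) -> stuffle f g x = 0.
Proof.
move=> g0; rewrite (@eq_stuffle _ (fun y => 1 * f y) g (fun y => 0 * g y)).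
- by rewrite stuffleZ mulr0 mul0r.
- by move=> y; rewrite mul1r.
- by move=> y; rewrite g0 mul0r.
Qed.

(** Off the empty list [monomial [::]] is zero, so every multiplicity has to
    come entirely from [g]. *)
Lemma stuffle_nill g x : all (ltn 0) x -> stuffle (monomial [::]) g x = g x.
Proof.
elim: x g => [|m x IHx] g /=; first by rewrite mul1r.
case/andP=> m_gt0 x_gt0; rewrite big_nat_recr //= subnn big_nat big1 ?add0r.
  by rewrite IHx //; case: m m_gt0.
move=> k /andP[_ lt_km]; apply: stuffle0l => y.
by rewrite -(subnSK lt_km).
Qed.

Lemma stuffle_nilr f x : all (ltn 0) x -> stuffle f (monomial [::]) x = f x.
Proof.
elim: x f => [|m x IHx] f /=; first by rewrite mulr1.
case/andP=> m_gt0 x_gt0; rewrite big_ltn //= subn0 big_nat big1 ?addr0.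
  by rewrite IHx //; case: m m_gt0.
by move=> -[|k] // _; apply: stuffle0r.
Qed.

(** By recursion on the head multiplicity [m]: it comes from one side, or it is
    split as [(m - k) + k] with [0 < k < m], and then
    [convolved_power_sum] turns its weight into a polynomial of degree
    [v + v' + 1]. The degree thus grows by one for each coincidence of parts,
    of which there are at most [minn (size w) (size w')]. *)
Lemma poly_weight_stuffle w w' :
  poly_weight (sumn w + sumn w' + minn (size w) (size w'))
    (stuffle (monomial w) (monomial w')).
Proof.
elim: w w' => [|v u IHu] w'.
  rewrite min0n addn0; apply: (eq_poly_weight _ (poly_weight_monomial w')) => x.
  exact: stuffle_nill.
elim: w' => [|v' u' IHu'].
  rewrite minn0 !addn0; apply: (eq_poly_weight _ (poly_weight_monomial _)) => x.
  exact: stuffle_nilr.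
have [p sz_p pE] := convolved_power_sum v v'.
apply: (@eq_poly_weight _ _ (fun x =>
  cons_weight (fun m => m%:R ^+ v)
    (stuffle (monomial u) (monomial (v' :: u'))) x +
  (cons_weight (fun m => m%:R ^+ v')
    (stuffle (monomial (v :: u)) (monomial u')) x +
  cons_weight (fun m => p.[m%:R]) (stuffle (monomial u) (monomial u')) x))).
  move=> [|m x]; first by rewrite /= !addr0 mulr0.
  case/andP=> m_gt0 _; rewrite /cons_weight -pE //.
  rewrite [LHS]/stuffle -/stuffle big_ltn // big_nat_recr //= subn0 subnn.
  rewrite addrA addrAC -!addrA; congr (_ + _); last congr (_ + _).
  - rewrite -[m%:R ^+ v]mulr1 -stuffleZ; apply: eq_stuffle => y.
      by case: m m_gt0.
    by rewrite mul1r.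
  - rewrite -[m%:R ^+ v']mul1r -stuffleZ; apply: eq_stuffle => y.
      by rewrite mul1r.
    by case: m m_gt0.
  rewrite mulr_suml; apply: eq_big_nat => k /andP[k_gt0 lt_km].
  rewrite -stuffleZ; apply: eq_stuffle => y; first by rewrite -(subnSK lt_km).
  by case: k k_gt0 {lt_km}.
apply: poly_weightD; [|apply: poly_weightD].
- apply: poly_weight_leq (poly_weight_cons_exp _ (IHu (v' :: u'))).
  by rewrite /= !minnE /=; lia.
- apply: poly_weight_leq (poly_weight_cons_exp _ IHu').
  by rewrite /= !minnE /=; lia.
- apply: poly_weight_leq
    (poly_weight_cons_poly sz_p (fun m _ => erefl) (IHu u')).
  by rewrite /= !minnE /=; lia.
Qed.

(** * Partitions weighted by their distinct parts, and conjugation *)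

(** The sum of [g y * 'X^n] over the partitions of any [n] into [l] distinct
    parts greater than [t], where [y] lists the distinct parts themselves in
    increasing order; each is repeated [u] times with no influence on the
    weight. *)
Fixpoint part_series (N l t : nat) (g : seq nat -> rat) : {poly rat} :=
  if l is l'.+1 then
    \sum_(t.+1 <= T < N.+1) \sum_(1 <= u < N.+1)
      'X^(u * T) * part_series N l' T (fun x => g (T :: x))
  else (g [::])%:P.

Lemma eq_part_series N l t g h :
  g =1 h -> part_series N l t g = part_series N l t h.
Proof.
elim: l t g h => [|l IHl] t g h eqgh /=; first by rewrite eqgh.
apply: eq_bigr => T _; apply: eq_bigr => u _; congr (_ * _).
by apply: IHl => x; apply: eqgh.
Qed.

Lemma part_seriesD N l t g h :
  part_series N l t (fun x => g x + h x) =
  part_series N l t g + part_series N l t h.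
Proof.
elim: l t g h => [|l IHl] t g h /=; first by rewrite rmorphD.
rewrite -big_split; apply: eq_bigr => T _ /=.
rewrite -big_split; apply: eq_bigr => u _ /=.
by rewrite IHl mulrDr.
Qed.

Lemma part_seriesZ N l t c g :
  part_series N l t (fun x => c * g x) = c%:P * part_series N l t g.
Proof.
elim: l t g => [|l IHl] t g /=; first by rewrite rmorphM.
rewrite mulr_sumr; apply: eq_bigr => T _ /=.
rewrite mulr_sumr; apply: eq_bigr => u _ /=.
by rewrite IHl mulrCA.
Qed.

(** If [x] lists the multiplicities of a partition, largest part first, then
    the partial sums of [x] are the distinct parts of the conjugate partition,
    in increasing order. *)
Fixpoint partial_sums (t : nat) (x : seq nat) : seq nat :=
  if x is m :: y then (t + m)%N :: partial_sums (t + m) y else [::].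

Definition on_size l (f : seq nat -> rat) x : rat :=
  if size x == l then f x else 0.

(** In the Young diagram let [s] be the largest part on the conjugate side, [m]
    its multiplicity, and [T = t + m] the smallest part on the part side, [u]
    its multiplicity. Cutting off the [u * T] boxes of [T] leaves a diagram
    whose conjugate has largest part [s' = s - u]. The offset [t] adds
    [t * s] boxes; it makes the statement stable under this recursion, because
    the remaining parts are measured from [T]. *)
Lemma part_series_from_conjugate N l t g :
  eq_upto N (part_series N l.+1 t g)
    (\sum_(1 <= s < N.+1) \sum_(1 <= m < N.+1) 'X^((t + m) * s) *
       mult_series N s.-1
         (on_size l (fun x => g ((t + m)%N :: partial_sums (t + m) x)))).
Proof.
elim: l t g => [|l IHl] t g.
  rewrite exchange_big /=.
  apply: eq_upto_trans (eq_upto_sum_shift t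
    (F := fun T => \sum_(1 <= u < N.+1) 'X^(u * T) * (g [:: T])%:P) _) _.
    move=> T ltNT; apply: eq_upto_sum0 => u /andP[u_gt0 _]; apply: eq_upto_Xn0.
    by rewrite (leq_trans ltNT) // leq_pmull.
  rewrite (_ : \sum_(_ <= _ < _) _ = \sum_(1 <= m < N.+1) \sum_(1 <= s < N.+1)
    'X^((t + m) * s) * (g [:: (t + m)%N])%:P); last first.
    by apply: eq_bigr => m _; apply: eq_bigr => s _; rewrite mulnC.
  apply: eq_upto_sum_nat => m _; apply: eq_upto_sum_nat => s _.
  rewrite [mult_series _ _ _]mult_series_largest.
  rewrite [X in _ + X]big1_seq ?addr0 // => s' _; rewrite big1_seq // => m' _.
  by rewrite mult_series0 mulr0.
rewrite [part_series _ _ _ _]/=.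
pose E T s' := \sum_(1 <= m' < N.+1) 'X^(m' * s') *
  mult_series N s'.-1
    (on_size l (fun x => g [:: T, (T + m')%N & partial_sums (T + m') x])).
pose F T := \sum_(1 <= s < N.+1) 'X^(T * s) * \sum_(1 <= s' < s) E T s'.
apply: (@eq_upto_trans _ (\sum_(t.+1 <= T < N.+1) F T)).
  apply: eq_upto_sum_nat => T /andP[ltT _].
  pose G a b := 'X^(T * (a + b)) * E T b.
  apply: (@eq_upto_trans _ (\sum_(1 <= u < N.+1) \sum_(1 <= s' < N.+1) G u s')).
    apply: eq_upto_sum_nat => u _.
    have IH := eq_uptoM (@eq_upto_refl N 'X^(u * T))
      (IHl T (fun x => g (T :: x))).
    apply: (eq_upto_trans IH).
    rewrite mulr_sumr; apply: eq_upto_sum_nat => s' _.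
    rewrite /G /E !mulr_sumr; apply: eq_upto_sum_nat => m' _.
    rewrite !mulrA -!exprD.
    by have -> : (u * T + (T + m') * s' = T * (u + s') + m' * s')%N by lia.
  apply: eq_upto_trans (eq_upto_antidiag1 (G := G) _) _.
    move=> a b ltN; apply: eq_upto_Xn0; apply: (leq_trans ltN).
    by rewrite leq_pmull // (leq_trans _ ltT).
  apply: eq_upto_sum_nat => s _; rewrite mulr_sumr.
  apply: eq_upto_sum_nat => s' /andP[_ lt].
  by rewrite /G subnK // ltnW.
apply: eq_upto_trans (eq_upto_sum_shift t (F := F) _) _.
  move=> T ltNT; apply: eq_upto_sum0 => s /andP[s_gt0 _]; apply: eq_upto_Xn0.
  by rewrite (leq_trans ltNT) // leq_pmulr.
rewrite [X in eq_upto _ _ X]exchange_big /=.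
apply: eq_upto_sum_nat => m _; apply: eq_upto_sum_nat => s /andP[s_gt0 _].
by rewrite mult_series_largest add0r prednK //.
Qed.

Lemma part_series_conjugate N l g : (0 < l)%N ->
  eq_upto N (part_series N l 0 g)
    (mult_series N N (on_size l (fun x => g (partial_sums 0 x)))).
Proof.
case: l => // l _; rewrite mult_series_largest add0r.
apply: eq_upto_trans (part_series_from_conjugate l 0 g) _.
by apply: eq_upto_sum_nat => s _; apply: eq_upto_sum_nat => m _; rewrite add0n.
Qed.

(** * The Euler derivation on part-weighted series *)

(** The weight of a partition from which one distinct part [T] has been deleted
    altogether, multiplied by [T] and summed over the choices of [T]. *)
Fixpoint insertion (g : seq nat -> rat) (x : seq nat) : rat :=
  if x is T :: y then T%:R * g y + insertion (fun z => g (T :: z)) y else 0.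

(** The truncation of the sum of [S * 'X^S / (1 - 'X^S)] over [S > t]; for
    [t = 0] its coefficients are the sums of divisors. *)
Definition sigma_series N t : {poly rat} :=
  \sum_(t.+1 <= S < N.+1) \sum_(1 <= U < N.+1) S%:R%:P * 'X^(U * S).

Definition theta (P : {poly rat}) := 'X * P^`().

Lemma thetaM P Q : theta (P * Q) = theta P * Q + P * theta Q.
Proof. by rewrite /theta derivM; ring. Qed.

Lemma thetaXn k : theta 'X^k = k%:R%:P * 'X^k.
Proof.
case: k => [|k]; first by rewrite /theta expr0 derivC mulr0 mul0r.
by rewrite /theta derivXn mulrnAr -exprS -mulr_natl -polyC_natr.
Qed.

Lemma theta_sum (I : Type) (r : seq I) (F : I -> {poly rat}) :
  theta (\sum_(i <- r) F i) = \sum_(i <- r) theta (F i).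
Proof. by rewrite /theta raddf_sum mulr_sumr. Qed.

Lemma coef_theta P n : (theta P)`_n = n%:R * P`_n.
Proof. by case: n => [|n]; rewrite coefXM ?mul0r // coef_deriv mulr_natl. Qed.

Lemma sum_trichotomy (M : nmodType) a b (F : nat -> nat -> M) :
  \sum_(a <= i < b) \sum_(a <= j < b) F i j =
  \sum_(a <= i < b) \sum_(i.+1 <= j < b) F i j + \sum_(a <= i < b) F i i +
  \sum_(a <= j < b) \sum_(j.+1 <= i < b) F i j.
Proof.
have -> : \sum_(a <= j < b) \sum_(j.+1 <= i < b) F i j =
    \sum_(a <= i < b) \sum_(a <= j < i) F i j.
  under [RHS]eq_big_nat => i /andP[_ ltib] do
    rewrite (big_nat_widen _ _ b) ?(ltnW ltib) //=.
  rewrite (exchange_big_dep_nat xpredT) //=.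
  by apply: eq_big_nat => j /andP[leaj _]; rewrite (big_nat_widenl _ a) // ltnW.
rewrite -!big_split; apply: eq_big_nat => i /andP[leai ltib] /=.
rewrite (@big_cat_nat _ _ _ i) ?(ltnW ltib) //= addrC; congr (_ + _).
by rewrite big_ltn // addrC.
Qed.

Local Arguments part_series : simpl never.

(** Multiplying by [sigma_series] adds [U >= 1] copies of a part [S] to a
    partition, with a factor [S]. Given the result, [S] and the multiplicity
    [u] of [S] in it, either [U = u] and [S] is a new part, which gives
    [insertion g]; or [U < u], which happens in [u - 1] ways and leaves the
    set of parts and hence the weight unchanged. The sum of [S * (u - 1)] over
    the distinct parts is the size of the partition, produced by [theta], minus
    the sum of its distinct parts. *)
Lemma theta_part_series N l t g :
  eq_upto N
    (sigma_series N t * part_series N l t g +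
     part_series N l t (fun x => (sumn x)%:R * g x))
    (theta (part_series N l t g) + part_series N l.+1 t (insertion g)).
Proof.
elim: l t g => [|l IHl] t g.
  rewrite /part_series /= mul0r addr0 /theta derivC mulr0 add0r mulr_suml.
  apply: eq_upto_sum_nat => S _; rewrite mulr_suml.
  apply: eq_upto_sum_nat => U _.
  by rewrite addr0 rmorphM mulrCA mulrA.
pose W T := part_series N l T (fun x => g (T :: x)).
have VE S : part_series N l.+1 S g =
  \sum_(S.+1 <= T < N.+1) \sum_(1 <= u < N.+1) 'X^(u * T) * W T by [].
(* The added part S lies below, at or above the smallest part T. *)
pose below := \sum_(t.+1 <= S < N.+1) \sum_(1 <= U < N.+1)
  'X^(U * S) * (S%:R%:P * part_series N l.+1 S g).
pose same := \sum_(t.+1 <= T < N.+1) \sum_(1 <= u < N.+1)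
  (u.-1 * T)%:R%:P * 'X^(u * T) * W T.
pose above := \sum_(t.+1 <= T < N.+1) \sum_(1 <= u < N.+1)
  'X^(u * T) * (sigma_series N T * W T).
have sigmaE : eq_upto N (sigma_series N t * part_series N l.+1 t g)
    (below + same + above).
  have splitE : sigma_series N t * part_series N l.+1 t g = below +
      \sum_(t.+1 <= T < N.+1) (\sum_(1 <= U < N.+1) \sum_(1 <= u < N.+1)
         T%:R%:P * 'X^((U + u) * T) * W T) + above.
    pose G S T := \sum_(1 <= U < N.+1) \sum_(1 <= u < N.+1)
      'X^(U * S) * (S%:R%:P * ('X^(u * T) * W T)).
    have -> : sigma_series N t * part_series N l.+1 t g =
        \sum_(t.+1 <= S < N.+1) \sum_(t.+1 <= T < N.+1) G S T.
      rewrite /sigma_series mulr_suml; apply: eq_bigr => S _.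
      rewrite mulr_suml exchange_big; apply: eq_bigr => U _ /=.
      rewrite VE mulr_sumr; apply: eq_bigr => T _; rewrite mulr_sumr.
      by apply: eq_bigr => u _; rewrite -mulrA mulrCA.
    have -> : below = \sum_(t.+1 <= S < N.+1) \sum_(S.+1 <= T < N.+1) G S T.
      apply: eq_bigr => S _; rewrite exchange_big; apply: eq_bigr => U _ /=.
      rewrite VE !mulr_sumr; apply: eq_bigr => T _; rewrite !mulr_sumr.
      by apply: eq_bigr => u _.
    have -> : above = \sum_(t.+1 <= T < N.+1) \sum_(T.+1 <= S < N.+1) G S T.
      apply: eq_bigr => T _.
      rewrite /G; under [RHS]eq_bigr do rewrite exchange_big.
      rewrite [RHS]exchange_big; apply: eq_bigr => u _ /=.
      rewrite mulr_suml mulr_sumr; apply: eq_bigr => S _.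
      rewrite mulr_suml mulr_sumr; apply: eq_bigr => U _.
      by rewrite mulrCA -!mulrA mulrCA.
    rewrite sum_trichotomy; congr (_ + _ + _).
    apply: eq_bigr => T _; apply: eq_bigr => U _; apply: eq_bigr => u _.
    by rewrite mulnDl exprD mulrCA !mulrA.
  (* For S = T only the total multiplicity c = U + u counts; it arises from
     c - 1 pairs, whence the factor u.-1 in [same]. *)
  rewrite splitE; apply: eq_uptoD => //; apply: eq_uptoD => //.
  apply: eq_upto_sum_nat => T /andP[ltT _].
  pose G a b := T%:R%:P * 'X^((a + b) * T) * W T.
  apply: eq_upto_trans (eq_upto_antidiag1 (G := G) _) _.
    move=> a b ltN; rewrite /G mulrAC mulrC; apply: eq_upto_Xn0.
    apply: (leq_trans ltN).
    by rewrite leq_pmulr // (leq_trans _ ltT).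
  apply: eq_upto_sum_nat => c /andP[c_gt0 _].
  rewrite (@eq_big_nat _ _ _ 1 c _ (fun=> T%:R%:P * 'X^(c * T) * W T));
    last first.
    by move=> b /andP[_ ltbc]; rewrite /G subnK // ltnW.
  rewrite sumr_const_nat subn1 natrM polyCM -[_ *+ c.-1]mulr_natl.
  by rewrite [c.-1%:R%:P]polyC_natr !mulrA.
have sumnE : part_series N l.+1 t (fun x => (sumn x)%:R * g x) =
  \sum_(t.+1 <= T < N.+1) \sum_(1 <= u < N.+1) 'X^(u * T) *
     (T%:R%:P * W T + part_series N l T (fun x => (sumn x)%:R * g (T :: x))).
  apply: eq_bigr => T _; apply: eq_bigr => u _.
  rewrite -part_seriesZ -part_seriesD; congr (_ * _).
  by apply: eq_part_series => x; rewrite natrD mulrDl.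
have insE : part_series N l.+2 t (insertion g) = below + \sum_(t.+1 <= T < N.+1)
    \sum_(1 <= u < N.+1) 'X^(u * T) *
      part_series N l.+1 T (insertion (fun x => g (T :: x))).
  rewrite /below -big_split; apply: eq_bigr => T _ /=.
  rewrite -big_split; apply: eq_bigr => u _ /=.
  by rewrite -mulrDr -part_seriesZ -part_seriesD.
have thetaE : theta (part_series N l.+1 t g) = \sum_(t.+1 <= T < N.+1)
    \sum_(1 <= u < N.+1) ((u * T)%:R%:P * 'X^(u * T) * W T +
      'X^(u * T) * theta (W T)).
  rewrite VE theta_sum; apply: eq_bigr => T _; rewrite theta_sum.
  by apply: eq_bigr => u _; rewrite thetaM thetaXn.
rewrite insE thetaE sumnE.
apply: eq_upto_trans (eq_uptoD sigmaE (@eq_upto_refl N _)) _.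
rewrite [X in eq_upto _ _ X]addrCA -!addrA; apply: eq_uptoD => //.
rewrite /same /above -!big_split; apply: eq_upto_sum_nat => T _ /=.
rewrite -!big_split; apply: eq_upto_sum_nat => u /andP[u_gt0 _] /=.
rewrite -addrA -mulrDr.
have -> : (u.-1 * T)%:R%:P = (u * T)%:R%:P - T%:R%:P :> {poly rat}.
  by rewrite -{2}(prednK u_gt0) mulSn natrD polyCD addrAC subrr add0r.
set sumW := part_series N l T (fun x => (sumn x)%:R * g (T :: x)).
rewrite [X in eq_upto _ X _](_ : _ = (u * T)%:R%:P * 'X^(u * T) * W T +
  'X^(u * T) * (sigma_series N T * W T + sumW)); last by ring.
by rewrite -mulrDr; apply: eq_uptoD => //; apply: eq_uptoM => //; apply: IHl.
Qed.

(** * Conjugated weights are polynomial *)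

Lemma monomial_size w x : size x != size w -> monomial w x = 0.
Proof.
by elim: w x => [|v w IHw] [|m x] //= neq; rewrite IHw ?mulr0.
Qed.

Lemma poly_weight_on_size k l f :
  poly_weight k f -> poly_weight k (on_size l f).
Proof.
case=> r kr fE; exists [seq p <- r | size p.2 == l].
  by apply/allP=> p; rewrite mem_filter => /andP[_]; apply: (allP kr).
move=> x x0; rewrite big_filter big_mkcond /on_size.
case: eqP => [<-|neq]; [rewrite fE //; apply: eq_bigr | apply/esym/big1] => p _.
  by case: eqP => // /eqP neq; rewrite monomial_size ?mulr0 1?eq_sym.
by case: eqP => // eq_l; rewrite monomial_size ?mulr0 // eq_l; apply/eqP.
Qed.

Lemma sumn_partial_sums t x :
  sumn (partial_sums t x) = (size x * t + sumn (partial_sums 0 x))%N.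
Proof.
elim: x t => [|m x IHx] t //=.
by rewrite IHx [sumn (partial_sums (0 + m) x)]IHx; lia.
Qed.

(** The head [m] enters each of the [size x + 1] partial sums, and on the
    support of the monomial that number is constant. *)
Lemma poly_weight_sumn_partial_sums w :
  poly_weight (sumn w).+1
    (fun x => (sumn (partial_sums 0 x))%:R * monomial w x).
Proof.
elim: w => [|v w IHw].
  by apply: (eq_poly_weight _ (poly_weight0 _)) => -[|m x] _ /=;
    rewrite ?mul0r ?mulr0.
apply: (@eq_poly_weight _ _ (fun x =>
  (size w).+1%:R * cons_weight (fun m => m%:R ^+ v.+1) (monomial w) x +
  cons_weight (fun m => m%:R ^+ v)
    (fun x => (sumn (partial_sums 0 x))%:R * monomial w x) x)).
  move=> [|m x] _; first by rewrite /= !mulr0 addr0.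
  rewrite [partial_sums _ _]/= add0n [sumn _]/= sumn_partial_sums.
  rewrite [monomial _ _]/= /cons_weight.
  have [eq_sz|neq_sz] := eqVneq (size x) (size w); last first.
    by rewrite monomial_size // !mulr0 addr0.
  by rewrite -eq_sz !natrD natrM -natr1 exprS; ring.
apply: poly_weightD.
  apply: poly_weightZ.
  exact: (poly_weight_cons_exp v.+1 (poly_weight_monomial w)).
by apply: poly_weight_leq (poly_weight_cons_exp v IHw); rewrite /= addnS.
Qed.

Fixpoint differences (t : nat) (x : seq nat) : seq nat :=
  if x is T :: y then (T - t)%N :: differences T y else [::].

Lemma partial_sumsK t : cancel (partial_sums t) (differences t).
Proof. by move=> x; elim: x t => //= m x IHx t; rewrite IHx addKn. Qed.

Definition add_head m x := if x is m' :: y then (m + m')%N :: y else [::].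

(** Deleting the first part [t + m] of a list of parts merges its
    multiplicity on the conjugate side with the next one. *)
Lemma differences_partial_sums t m x :
  differences t (partial_sums (t + m) x) = add_head m x.
Proof. by case: x => //= m' x; rewrite partial_sumsK -addnA addKn. Qed.

Lemma eq_insertion g h : g =1 h -> insertion g =1 insertion h.
Proof.
move=> + x; elim: x g h => //= T x IHx g h eqgh.
by rewrite eqgh; congr (_ + _); apply: IHx => y; apply: eqgh.
Qed.

Lemma insertionZ c g x : insertion (fun y => c * g y) x = c * insertion g x.
Proof.
elim: x g => [|T x IHx] g /=; first by rewrite mulr0.
by rewrite IHx mulrDr mulrCA.
Qed.

Lemma insertion_partial_sums f t m x :
  insertion (fun z => f (differences t z)) (partial_sums t (m :: x)) =
  (t + m)%:R * f (add_head m x) +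
  insertion (fun z => f (m :: differences (t + m) z)) (partial_sums (t + m) x).
Proof.
rewrite /= differences_partial_sums; congr (_ + _); apply: eq_insertion => z.
by rewrite addKn.
Qed.

Lemma monomial_add_head v w m x :
  monomial (v :: w) (add_head m x) =
  \sum_(i < v.+1) 'C(v, i)%:R * (m%:R ^+ (v - i) * monomial (val i :: w) x).
Proof.
case: x => [|m' x] /=; first by rewrite big1 // => i _; rewrite !mulr0.
rewrite natrD exprDn mulr_suml; apply: eq_bigr => i _.
by rewrite -mulr_natl; ring.
Qed.

(** Deleting a distinct part replaces two adjacent multiplicities by their sum,
    or drops the last one; a power of that sum expands by the binomial theorem.
    The deleted part is a partial sum of multiplicities starting from [t], so
    the dependence on [t] is affine; stating it explicitly lets the recursion
    go through, where [t] becomes [t + m]. *)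
Lemma poly_weight_insertion w : exists A B,
  [/\ poly_weight (sumn w) A, poly_weight (sumn w).+1 B &
   forall t x, all (ltn 0) x ->
   insertion (fun z => monomial w (differences t z)) (partial_sums t x) =
   t%:R * A x + B x].
Proof.
elim: w => [|v w [A [B [wA wB insE]]]].
  exists (cons_weight (fun m => m%:R ^+ 0) (monomial [::])).
  exists (cons_weight (fun m => m%:R ^+ 1) (monomial [::])).
  split; [exact: (poly_weight_cons_exp 0 (poly_weight_monomial [::])) |
          exact: (poly_weight_cons_exp 1 (poly_weight_monomial [::])) |].
  move=> t [|m x] _; first by rewrite /= !mulr0 addr0.
  rewrite insertion_partial_sums (@eq_insertion _ (fun=> 0 * 0)); last first.
    by move=> z; rewrite mulr0.
  rewrite insertionZ.
  rewrite /cons_weight expr0 expr1 mul0r addr0 natrD mul1r -mulrDl.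
  by case: x.
pose F d (x : seq nat) := \sum_(i < v.+1)
  'C(v, i)%:R *
  cons_weight (fun m => m%:R ^+ (d + (v - i))) (monomial (val i :: w)) x.
have wF d : poly_weight (d + sumn (v :: w)) (F d).
  apply: poly_weight_sum => i; apply: poly_weightZ.
  apply: poly_weight_leq (poly_weight_cons_exp _ (poly_weight_monomial _)).
  by have := ltn_ord i; rewrite /=; lia.
exists (fun x => F 0 x + cons_weight (fun m => m%:R ^+ v) A x).
exists (fun x => F 1 x +
  (cons_weight (fun m => m%:R ^+ v.+1) A x +
   cons_weight (fun m => m%:R ^+ v) B x)).
split.
- by apply: poly_weightD; [exact: (wF 0%N) | exact: poly_weight_cons_exp].
- apply: poly_weightD; first exact: (wF 1%N).
  apply: poly_weightD; first exact: (poly_weight_cons_exp v.+1 wA).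
  by rewrite [sumn _]/= -addnS; exact: poly_weight_cons_exp.
have FE d m x : F d (m :: x) = m%:R ^+ d * monomial (v :: w) (add_head m x).
  rewrite monomial_add_head mulr_sumr; apply: eq_bigr => i _.
  by rewrite /cons_weight exprD; ring.
move=> t [|m x].
  by move=> _ /=; rewrite /F !big1 ?addr0 ?mulr0 // => i _; rewrite mulr0.
case/andP=> _ x_gt0; rewrite insertion_partial_sums !FE /cons_weight.
rewrite (@eq_insertion _ (fun z =>
  m%:R ^+ v * monomial w (differences (t + m) z))) // insertionZ insE //.
by rewrite natrD exprS expr0 expr1; ring.
Qed.

(** * MacMahonesque functions as coefficients *)

(** The bound [a] makes the range of parts recursive: once the largest part [b]
    is removed, the others are increasing and below [b]. *)
Definition increasing_below l N a (s : {ffun 'I_l -> 'I_N.+1}) :=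
  [&& [forall i, 0 < s i]%N,
      [forall i : 'I_l, forall j : 'I_l, (i < j) ==> (s i < s j)]%N &
      [forall i, s i < a]%N].

Lemma increasing_belowP l N a (s : {ffun 'I_l -> 'I_N.+1}) :
  reflect [/\ forall i, (0 < s i)%N,
              forall i j : 'I_l, (i < j)%N -> (s i < s j)%N &
              forall i, (s i < a)%N] (increasing_below a s).
Proof.
apply: (iffP and3P) => -[s_gt0 s_incr s_lt]; split; try exact/forallP.
  by move=> i j; apply/implyP; move: i j; apply/'forall_forallP.
by apply/'forall_forallP => i j; apply/implyP/s_incr.
Qed.

Definition cons_last l N (p : 'I_N.+1 * {ffun 'I_l -> 'I_N.+1}) :
    {ffun 'I_l.+1 -> 'I_N.+1} :=
  [ffun i => if unlift ord_max i is Some j then p.2 j else p.1].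

Lemma cons_last_max l N b (s : {ffun 'I_l -> 'I_N.+1}) :
  cons_last (b, s) ord_max = b.
Proof. by rewrite ffunE unlift_none. Qed.

Lemma cons_last_lift l N b (s : {ffun 'I_l -> 'I_N.+1}) i :
  cons_last (b, s) (lift ord_max i) = s i.
Proof. by rewrite ffunE liftK. Qed.

Lemma cons_last_bij l N : bijective (@cons_last l N).
Proof.
exists (fun s : {ffun 'I_l.+1 -> 'I_N.+1} =>
  (s ord_max, [ffun j : 'I_l => s (lift ord_max j)])) => [[b s]|s].
  rewrite cons_last_max; congr (_, _); apply/ffunP => j.
  by rewrite ffunE cons_last_lift.
by apply/ffunP => i; rewrite ffunE; case: unliftP => [j|] -> //=; rewrite ffunE.
Qed.

Lemma increasing_below_cons_last l N a b (s : {ffun 'I_l -> 'I_N.+1}) :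
  increasing_below a (cons_last (b, s)) = (0 < b < a)%N && increasing_below b s.
Proof.
apply/increasing_belowP/andP => [[p_gt0 p_incr p_lt]|
  [/andP[b_gt0 lt_ba] /increasing_belowP[s_gt0 s_incr s_lt]]].
  split.
    have := p_gt0 ord_max; have := p_lt ord_max.
    by rewrite cons_last_max => -> ->.
  apply/increasing_belowP; split=> [i|i j lt_ij|i].
  - by have := p_gt0 (lift ord_max i); rewrite cons_last_lift.
  - have := p_incr (lift ord_max i) (lift ord_max j); rewrite !cons_last_lift.
    by apply; rewrite !lift_max.
  - have := p_incr (lift ord_max i) ord_max.
    by rewrite cons_last_lift cons_last_max; apply; rewrite lift_max /=.
split=> [i|i j|i].
- by case: (unliftP ord_max i) => [j|] ->;
    rewrite ?cons_last_lift ?cons_last_max.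
- case: (unliftP ord_max i) => [i'|] ->; case: (unliftP ord_max j) => [j'|] ->;
    rewrite ?cons_last_lift ?cons_last_max ?lift_max //=.
  + exact: s_incr.
  + by rewrite ltnNge (ltnW (ltn_ord j')).
  + by rewrite ltnn.
- case: (unliftP ord_max i) => [j|] ->;
    rewrite ?cons_last_lift ?cons_last_max //.
  exact: ltn_trans (s_lt j) lt_ba.
Qed.

(** The sum over multiplicities is written as a product over the parts; the
    terms of its expansion are the monomials of the definition of
    [MacMahonesque]. *)
Definition MacMahonesque_series N l (v : nat -> nat) a : {poly rat} :=
  \sum_(s : {ffun 'I_l -> 'I_N.+1} | increasing_below a s)
    \prod_(i < l) \sum_(m < N.+1 | (0 < m)%N) (m%:R ^+ v i)%:P * 'X^(m * s i).

Lemma MacMahonesque_series_recr N l v a : (a <= N.+1)%N ->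
  MacMahonesque_series N l.+1 v a = \sum_(1 <= b < a)
    (\sum_(1 <= m < N.+1) (m%:R ^+ v l)%:P * 'X^(m * b)) *
    MacMahonesque_series N l v b.
Proof.
move=> le_aN; rewrite /MacMahonesque_series.
rewrite (reindex _ (onW_bij _ (@cons_last_bij l N))) /=.
rewrite [RHS](big_nat_widen _ _ N.+1) // [RHS](big_nat_widenl _ 0) // big_mkord.
rewrite (eq_bigr (fun b : 'I_N.+1 =>
  \sum_(s : {ffun 'I_l -> 'I_N.+1} | increasing_below b s)
  (\sum_(1 <= m < N.+1) (m%:R ^+ v l)%:P * 'X^(m * b)) *
   \prod_(i < l) \sum_(m < N.+1 | (0 < m)%N) (m%:R ^+ v i)%:P * 'X^(m * s i)));
  last by move=> b _; rewrite mulr_sumr.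
rewrite pair_big_dep /=; apply: eq_big => [[b s]|[b s] _] /=.
  by rewrite increasing_below_cons_last [(b < a)%N && _]andbC.
rewrite big_ord_recr /= mulrC; congr (_ * _).
  by rewrite (big_nat_widenl _ 0) // big_mkord cons_last_max.
apply: eq_bigr => i _.
rewrite (_ : widen_ord _ i = lift ord_max i) ?cons_last_lift //.
by apply: val_inj; rewrite /= /bump leqNgt ltn_ord.
Qed.

Lemma MacMahonesque_seriesE N l v a : (a <= N)%N ->
  MacMahonesque_series N l v a.+1 =
  mult_series N a (monomial (rev (mkseq v l))).
Proof.
elim: l a => [|l IHl] a le_aN.
  rewrite /MacMahonesque_series (big_pred1 [ffun=> ord0]) ?big_ord0; last first.
    move=> s; transitivity true; first by apply/increasing_belowP; split=> -[].
    by apply/esym/eqP/ffunP => -[].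
  rewrite mult_series_largest /= big1 ?addr0 // => b _; rewrite big1 // => m _.
  by rewrite mult_series0 mulr0.
rewrite MacMahonesque_series_recr // mult_series_largest mkseqS rev_rcons add0r.
apply: eq_big_nat => b /andP[b_gt0 lt_ba].
rewrite -{2}(prednK b_gt0) IHl; last by lia.
rewrite mulr_suml; apply: eq_bigr => m _.
by rewrite mult_seriesZ mulrCA mulrA mulrC mulrA.
Qed.

(** The vector is reversed because exponents are indexed from the smallest
    part, while [mult_series] lists multiplicities from the largest. *)
Lemma MacMahonesque_coef w n :
  (MacMahonesque w n)%:R = (mult_series n n (monomial (rev w)))`_n :> rat.
Proof.
rewrite -{2}(mkseq_nth 0%N w) -MacMahonesque_seriesE // coef_sum natr_sum.
apply: eq_big => [s|s _].
  rewrite /increasing_below; congr (_ && _); rewrite andbC.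
  by rewrite (_ : [forall i, _] = true) //; apply/forallP.
rewrite bigA_distr_big /= coef_sum natr_sum big_mkcondr /=.
apply: eq_big => [m|m _].
  by apply/forallP/ffun_onP.
rewrite big_split /= -expr_sum -rmorph_prod coefCM coefXn eq_sym.
case: eqP => _; last by rewrite mulr0.
by rewrite mulr1 natr_prod; apply: eq_bigr => i _; rewrite natrX.
Qed.

(** * Products and derivatives of MacMahonesque functions *)

Lemma coef_mult_series_stable n f i : (i <= n)%N ->
  (mult_series n n f)`_i = (mult_series i i f)`_i.
Proof.
move=> lein; rewrite (mult_series_mult_bound _ _ lein) //.
by rewrite (mult_series_part_bound _ _ lein).
Qed.

Lemma coef_mult_series_MacMahonesque n w i : (i <= n)%N ->
  (mult_series n n (monomial (rev w)))`_i = (MacMahonesque w i)%:R.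
Proof.
by move=> lein; rewrite coef_mult_series_stable // MacMahonesque_coef.
Qed.

Lemma MacMahonesque_n0 w : w != [::] -> MacMahonesque w 0 = 0%N.
Proof.
move=> w_n0; apply/eqP; rewrite -(eqr_nat rat) MacMahonesque_coef /= coefC /=.
rewrite monomial_size // size_rev; case: w w_n0 => //.
Qed.

Lemma MacMahonesque_nil n : (0 < n)%N -> MacMahonesque [::] n = 0%N.
Proof.
move=> n_gt0; apply/eqP; rewrite -(eqr_nat rat) MacMahonesque_coef.
rewrite mult_series_largest big1.
  by rewrite addr0 coefC; case: n n_gt0.
by move=> s _; apply: big1 => m _; rewrite mult_series0 mulr0.
Qed.

(** The coefficients of equal exponent vectors are collected. The empty vector
    may occur in the expansion, but no positive integer is a sum of zero
    parts. *)
Lemma poly_weight_expansion k f : poly_weight k f ->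
  exists c : {fsfun seq nat -> rat with 0}, forall n, (0 < n)%N ->
    (mult_series n n f)`_n =
    \sum_(w <- finsupp c | (0 < size w)%N && (sumn w <= k)%N)
      c w * (MacMahonesque w n)%:R.
Proof.
case=> r kr fE.
pose S := [fset rev p.2 | p in r]%fset.
pose F w := \sum_(p <- r | rev p.2 == w) p.1.
pose c : {fsfun seq nat -> rat with 0} := [fsfun w in S => F w]%fset.
exists c => n n_gt0.
have cE w : c w = F w.
  rewrite fsfunE; case: ifP => // /negP wS; rewrite /F big_seq_cond big1 //.
  by move=> p /andP[rp /eqP eq_w]; case: wS; rewrite -eq_w; apply: in_imfset.
rewrite [RHS]big_mkcond.
rewrite (eq_big_seq (fun w => c w * (MacMahonesque w n)%:R)); last first.
  move=> w /(fsubsetP (finsupp_sub _ _ _)) /imfsetP[p /= rp ->].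
  rewrite sumn_rev (allP kr p rp) andbT; case: ifP => //.
  by case: (rev _) => // _; rewrite MacMahonesque_nil ?mulr0.
rewrite (big_fset_incl _ (finsupp_sub _ _ _)) /=; last first.
  by move=> w _; rewrite memNfinsupp => /eqP ->; rewrite mul0r.
rewrite (eq_mult_series _ _ fE) mult_series_sum coef_sum.
under [RHS]eq_bigr do rewrite cE mulr_suml.
rewrite (exchange_big_dep xpredT) //=; apply: eq_big_seq => p rp.
rewrite big_mkcond (bigD1_seq (rev p.2)) ?fset_uniq //=; last exact: in_imfset.
rewrite eqxx.
rewrite big1 ?addr0 => [|w /negPf neq_w]; last by rewrite eq_sym neq_w.
by rewrite mult_seriesZ coefCM -{1}[p.2]revK MacMahonesque_coef.
Qed.

(** A product [m * s] can be read with either factor as the multiplicity: the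
    conjugation of rectangles. *)
Lemma mult_series_monomial1 N :
  mult_series N N (monomial [:: 1%N]) = sigma_series N 0.
Proof.
rewrite mult_series_largest add0r /sigma_series exchange_big.
apply: eq_bigr => m _; apply: eq_bigr => s _.
rewrite /= mult_seriesZ mulrCA mult_series_largest big1.
  by rewrite addr0 mulr1 expr1 mulnC.
by move=> s' _; apply: big1 => m' _; rewrite mult_series0 mulr0.
Qed.

(** Conjugation makes the weight a function [g] of the distinct parts, and
    [theta_part_series] then applies. Of its three terms the product with
    [sigma_series] has degree at most [1 + sumn w + 1], as a single part can
    coincide at most once; conjugated back, the other two have degree
    [sumn w + 1]. *)
Lemma theta_mult_series_monomial w : w != [::] ->
  exists2 f, poly_weight (sumn w).+2 f &
    forall N, eq_upto N (theta (mult_series N N (monomial w)))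
                        (mult_series N N f).
Proof.
move=> w_n0; set l := size w; have l_gt0 : (0 < l)%N by rewrite lt0n size_eq0.
pose g x := monomial w (differences 0 x).
have [A [B [_ wB insE]]] := poly_weight_insertion w.
pose P x := (sumn (partial_sums 0 x))%:R * monomial w x.
exists (fun x => stuffle (monomial [:: 1%N]) (monomial w) x +
  (on_size l P x + -1 * on_size l.+1 B x)).
  apply: poly_weightD; last apply: poly_weightD.
  - apply: poly_weight_leq (poly_weight_stuffle _ _).
    by have := geq_minl 1 (size w); rewrite /=; lia.
  - by apply: poly_weight_leq
      (poly_weight_on_size _ (poly_weight_sumn_partial_sums w)).
  - by apply: poly_weightZ; apply: poly_weight_leq (poly_weight_on_size _ wB).
move=> N; rewrite mult_seriesD mult_seriesD mult_seriesZ.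
have gE : eq_upto N (part_series N l 0 g) (mult_series N N (monomial w)).
  apply: eq_upto_trans (part_series_conjugate _ l_gt0) _.
  rewrite (@eq_mult_series _ _ _ (monomial w)) // => x _.
  by rewrite /on_size /g partial_sumsK; case: eqP => // /eqP/monomial_size ->.
have sumE : eq_upto N (part_series N l 0 (fun x => (sumn x)%:R * g x))
    (mult_series N N (on_size l P)).
  apply: eq_upto_trans (part_series_conjugate _ l_gt0) _.
  rewrite (@eq_mult_series _ _ _ (on_size l P)) // => x _.
  by rewrite /on_size /g partial_sumsK.
have insE' : eq_upto N (part_series N l.+1 0 (insertion g))
    (mult_series N N (on_size l.+1 B)).
  apply: eq_upto_trans (part_series_conjugate _ (ltn0Sn l)) _.
  rewrite (@eq_mult_series _ _ _ (on_size l.+1 B)) // => x x_gt0.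
  by rewrite /on_size insE // mul0r add0r.
move=> i lein.
have := theta_part_series l 0 g lein; rewrite !coefD.
rewrite (eq_uptoM (@eq_upto_refl _ _) gE lein) sumE // insE' //.
rewrite !coef_theta gE // -mult_series_monomial1 mult_seriesM //.
rewrite coefCM addrA => ->.
by rewrite mulN1r addrK.
Qed.

Theorem theorem1p4 :
  (forall (a b : nat) (alpha : a.-tuple nat) (beta : b.-tuple nat),
     (1 <= a)%N -> (1 <= b)%N ->
     (forall i : 'I_a, (0 < tnth alpha i)%N) ->
     (forall j : 'I_b, (0 < tnth beta j)%N) ->
     exists c : {fsfun seq nat -> rat with 0},
       forall n : nat, (0 < n)%N ->
         (\sum_(1 <= i < n)
            MacMahonesque alpha i * MacMahonesque beta (n - i))%N%:R =
         \sum_(w <- finsupp c |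
               (0 < size w)%N &&
               (sumn w <= sumn alpha + sumn beta + a + b - 1)%N)
            c w * (MacMahonesque w n)%:R :> rat)
  /\
  (forall (a : nat) (alpha : a.-tuple nat),
     (1 <= a)%N ->
     (forall i : 'I_a, (0 < tnth alpha i)%N) ->
     exists c : {fsfun seq nat -> rat with 0},
       forall n : nat, (0 < n)%N ->
         (n * MacMahonesque alpha n)%N%:R =
         \sum_(w <- finsupp c |
               (0 < size w)%N && (sumn w <= sumn alpha + a + 1)%N)
            c w * (MacMahonesque w n)%:R :> rat).
Proof.
split.
  move=> a b alpha beta a_gt0 b_gt0 _ _.
  have alpha_n0 : tval alpha != [::] by rewrite -size_eq0 size_tuple -lt0n.
  have beta_n0 : tval beta != [::] by rewrite -size_eq0 size_tuple -lt0n.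
  have wst := poly_weight_stuffle (rev alpha) (rev beta).
  rewrite !sumn_rev !size_rev !size_tuple in wst.
  have le_bound : (sumn alpha + sumn beta + minn a b <=
                   sumn alpha + sumn beta + a + b - 1)%N.
    by have := geq_minl a b; lia.
  have [c cE] := poly_weight_expansion (poly_weight_leq le_bound wst).
  exists c => n n_gt0; rewrite -cE // -(@mult_seriesM n n _ _ n) // coefM.
  rewrite -(big_mkord xpredT (fun i =>
    (mult_series n n (monomial (rev alpha)))`_i *
    (mult_series n n (monomial (rev beta)))`_(n - i))).
  rewrite (@eq_big_nat _ _ _ 0 n.+1 _ (fun i => (MacMahonesque alpha i)%:R *
    (MacMahonesque beta (n - i))%:R)); last first.
    by move=> i lt_in; rewrite !coef_mult_series_MacMahonesque // leq_subr.
  (* The extreme terms i = 0 and i = n of the Cauchy product vanish. *)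
  rewrite [RHS]big_ltn // big_nat_recr //= subnn !MacMahonesque_n0 //.
  rewrite mul0r mulr0 add0r addr0 natr_sum.
  by apply: eq_bigr => i _; rewrite natrM.
move=> a alpha a_gt0 _.
have ralpha_n0 : rev alpha != [::].
  by rewrite -size_eq0 size_rev size_tuple -lt0n.
have [f wf fE] := theta_mult_series_monomial ralpha_n0.
have le_bound : ((sumn (rev alpha)).+2 <= sumn alpha + a + 1)%N.
  by rewrite sumn_rev; lia.
have [c cE] := poly_weight_expansion (poly_weight_leq le_bound wf).
exists c => n n_gt0.
by rewrite -cE // -(fE n n) // coef_theta natrM MacMahonesque_coef.
Qed.
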